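(* Let $L\in\mathbb{N}$, let $\langle u_n\rangle_{n=1}^{\infty}$ be a sequence of real numbers, put $S_0=0$ and $S_n=u_1+\cdots+u_n$ for $n\in\mathbb{N}$, and for $i\in\{1,\dots,L\}$ define the sequence $\langle v^{i}_n\rangle_{n=1}^{\infty}$ by $$v^{i}_n=S_{i+(n-1)L}-S_{(n-1)L}\qquad(n\in\mathbb{N}).$$ If $\langle u_n\rangle_{n=1}^{\infty}$ is periodic with period $L$, then for every $i\in\{1,\dots,L\}$ the sequence $\langle v^{i}_n\rangle_{n=1}^{\infty}$ is constant. Conversely, if for each $i\in\{1,\dots,L\}$ the sequence $\langle v^{i}_n\rangle_{n=1}^{\infty}$ is constant, then $\langle u_n\rangle_{n=1}^{\infty}$ is periodic with period $L$.
   Context: $\mathbb{N}=\{1,2,3,\dots\}$. A sequence $\langle u_n\rangle_{n=1}^{\infty}$ is periodic with period $L$ if $u_{i+kL}=u_i$ for all $i\in\mathbb{N}$ and $k\in\mathbb{Z}$ with $i+kL\in\mathbb{N}$ (the period is not required to be minimal). *)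

(* Defs.v *)
From mathcomp Require Import all_boot all_order all_algebra reals.

Set Implicit Arguments.
Unset Strict Implicit.
Unset Printing Implicit Defensive.

Import Order.TTheory GRing.Theory Num.Theory.

Local Open Scope ring_scope.

(* A sequence indexed by the positive integers is represented by a function on
   nat; every notion below ignores its value at index 0. *)

(* The index i + k * L, with k a possibly negative integer, is computed in int;
   j is this index when it is a positive integer. *)
Definition periodic (T : Type) (u : nat -> T) (L : nat) : Prop :=
  forall (i j : nat) (k : int), (0 < i)%N -> (0 < j)%N ->
    j%:Z = i%:Z + k * L%:Z -> u j = u i.

Definition constant_seq (T : Type) (w : nat -> T) : Prop :=
  exists c : T, forall n : nat, (0 < n)%N -> w n = c.

Definition partial_sum (R : realType) (u : nat -> R) (n : nat) : R :=
  \sum_(1 <= m < n.+1) u m.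

(* Only n >= 1 matters, so n.-1 is the true n - 1. *)
Definition block_sum (R : realType) (u : nat -> R) (L i n : nat) : R :=
  partial_sum u (i + n.-1 * L)%N - partial_sum u (n.-1 * L)%N.

(* Main.v *)
(** Block sums are sums of shifted terms,
    [v^i_n = u_{1+(n-1)L} + ... + u_{i+(n-1)L}]. Periodicity makes every summand
    independent of [n]; conversely [u_{i+(n-1)L} = v^i_n - v^{i-1}_n] (with
    [v^0_n = 0]) does not depend on [n] for [1 <= i <= L], and every positive
    index has this form. *)
Require Import Defs.
From mathcomp Require Import all_boot all_order all_algebra reals.
From mathcomp Require Import zify.

Import GRing.Theory.
Local Open Scope ring_scope.

(** A shift by a negative multiple of [L] is a positive shift with [i] and [j] exchanged. *)
Lemma periodic_nat (T : Type) (u : nat -> T) (L : nat) :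
  (forall i k : nat, (0 < i)%N -> u (i + k * L)%N = u i) -> periodic u L.
Proof.
move=> uL i j [k|k] i_gt0 j_gt0 ij.
  by rewrite (_ : j = i + k * L)%N ?uL; last lia.
have -> : i = (j + k.+1 * L)%N by lia.
exact/esym/uL.
Qed.

Lemma periodic_addMn (T : Type) (u : nat -> T) (L i k : nat) :
  periodic u L -> (0 < i)%N -> u (i + k * L)%N = u i.
Proof. by move=> uL i_gt0; apply: (uL i _ k%:Z) => //; lia. Qed.

Lemma block_sumE (R : realType) (u : nat -> R) (L i n : nat) :
  block_sum u L i n = \sum_(1 <= m < i.+1) u (m + n.-1 * L)%N.
Proof.
rewrite /block_sum /partial_sum -addSn addnC.
(* The terms up to index [n.-1 * L] cancel; the remaining ones are reindexed from 1. *)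
rewrite (big_cat_nat (n := (n.-1 * L).+1)) //=; last by lia.
rewrite addrAC subrr add0r -[X in \sum_(X <= _ < _) _]add1n big_addn.
by have -> : (n.-1 * L + i.+1 - n.-1 * L = i.+1)%N by lia.
Qed.

Lemma block_sumS (R : realType) (u : nat -> R) (L i n : nat) :
  block_sum u L i.+1 n = block_sum u L i n + u (i.+1 + n.-1 * L)%N.
Proof. by rewrite !block_sumE big_nat_recr. Qed.

Lemma constant_block_sum_term (R : realType) (u : nat -> R) (L i k : nat) :
  (forall i : nat, (1 <= i <= L)%N -> constant_seq (block_sum u L i)) ->
  (i < L)%N -> u (i.+1 + k * L)%N = u i.+1.
Proof.
move=> vc iL.
have vE j : (j <= L)%N -> block_sum u L j k.+1 = block_sum u L j 1.
  (* The hypothesis starts at index 1; for [j = 0] both block sums are empty. *)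
  case: j => [|j] jL; first by rewrite !block_sumE !big_geq.
  by have [c vjc] := vc j.+1 jL; rewrite !vjc.
have := vE i.+1 iL; rewrite !block_sumS (vE i (ltnW iL)) /= mul0n addn0.
exact: addrI.
Qed.

Theorem theorem5p1 (R : realType) (L : nat) (hL : (0 < L)%N) (u : nat -> R) :
  (periodic u L ->
     forall i : nat, (1 <= i <= L)%N -> constant_seq (block_sum u L i)) /\
  ((forall i : nat, (1 <= i <= L)%N -> constant_seq (block_sum u L i)) ->
     periodic u L).
Proof.
split=> [uL i _|vc].
  (* The constant is the value at [n = 1], where the shift vanishes. *)
  exists (partial_sum u i) => n _; rewrite block_sumE.
  by apply: eq_big_nat => m /andP[m_gt0 _]; exact: periodic_addMn.
apply: periodic_nat => -[//|i] k _.
(* The index is [i.+1], so dividing [i] by [L] gives a remainder [r < L] with [r.+1] between 1 and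
   [L]; both sides then reduce to [u r.+1]. *)
rewrite (divn_eq i L) -addnS addnC addnA -mulnDl addnC [in RHS]addnC.
by rewrite !constant_block_sum_term ?ltn_pmod.
Qed.
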